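(* If $G$ is a graph with at least one edge, with chromatic number $\chi$, and $\beta_o:=\beta_o(G)$, then $$\chi\ge\frac{\beta_o}{1-\beta_o}.$$
   Context: All graphs are simple and undirected, with a finite vertex set. $A(G)$ is the adjacency matrix, $D(G)$ the diagonal matrix of vertex degrees, and $L(G)=D(G)-A(G)$ the Laplacian matrix of $G$. For $\beta\in[0,1]$, $B_\beta(G):=\beta A(G)+(1-\beta)L(G)$. The eigenvalues of a real symmetric $n\times n$ matrix $S$ are ordered $\lambda_1(S)\ge\cdots\ge\lambda_n(S)$ (with multiplicity). For a graph $G$ on $n$ vertices with at least one edge, $\beta_o(G):=\max\{\beta\in(0,1):\lambda_n(B_\beta(G))=0\}$. *)

(* Defs.v *)
From HB Require Import structures.
From mathcomp Require Import all_boot all_order all_algebra.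
From mathcomp Require Import polyrcf ring lra.
From mathcomp Require complex.
From mathcomp Require Import all_classical all_reals all_analysis.

Set Implicit Arguments.
Unset Strict Implicit.
Unset Printing Implicit Defensive.

Import Order.TTheory GRing.Theory Num.Theory.
Import numFieldNormedType.Exports.

Local Open Scope classical_set_scope.
Local Open Scope ring_scope.

Record sgraph := SGraph {
  vertex :> finType;
  adj : rel vertex;
  adj_sym : symmetric adj;
  adj_irr : irreflexive adj
}.

Definition degree (G : sgraph) (x : G) : nat := #|[pred y | adj x y]|.

Definition has_edge (G : sgraph) : Prop := exists x y : G, adj x y.

Definition colorable (G : sgraph) (k : nat) : bool :=
  [exists f : {ffun G -> 'I_k}, forall x, forall y, adj x y ==> (f x != f y)].

Lemma colorable_ex (G : sgraph) : exists k, colorable G k.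
Proof.
exists #|G|; apply/existsP; exists [ffun x => enum_rank x].
apply/forallP => x; apply/forallP => y; apply/implyP => xy; rewrite !ffunE.
by apply/negP => /eqP/enum_rank_inj exy; move: xy; rewrite exy adj_irr.
Qed.

Definition chromatic_number (G : sgraph) : nat := ex_minn (colorable_ex G).

(* Rows and columns are indexed by the vertices of G through enum_val. *)
Definition adjmx (R : realType) (G : sgraph) : 'M[R]_#|G| :=
  \matrix_(i, j) (adj (enum_val i) (enum_val j))%:R.

Definition degmx (R : realType) (G : sgraph) : 'M[R]_#|G| :=
  diag_mx (\row_i (degree (enum_val i))%:R).

Definition laplacian (R : realType) (G : sgraph) : 'M[R]_#|G| :=
  degmx R G - adjmx R G.

Definition Bmx (R : realType) (G : sgraph) (beta : R) : 'M[R]_#|G| :=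
  beta *: adjmx R G + (1 - beta) *: laplacian R G.

(* Real roots of the characteristic polynomial, repeated according to their
   multiplicity, in nonincreasing order; a symmetric matrix has all its n
   eigenvalues here, see size_eigenvalues and char_poly_eigenvalues. *)
Definition eigenvalues (R : realType) (n : nat) (S : 'M[R]_n) : seq R :=
  sort >=%R (flatten [seq nseq (mup x (char_poly S)) x
                     | x <- rootsR (char_poly S)]).

(* 1-based: lambda S k is the k-th largest eigenvalue for 1 <= k <= n. *)
Definition lambda (R : realType) (n : nat) (S : 'M[R]_n) (k : nat) : R :=
  nth 0 (eigenvalues S) k.-1.

Definition null_betas (R : realType) (G : sgraph) : set R :=
  [set beta | 0 < beta < 1 /\ lambda (Bmx G beta) #|G| = 0].

(* The maximum exists as soon as G has an edge, see beta_oP; the value 0 given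
   to edgeless graphs is arbitrary. *)
Definition beta_o (R : realType) (G : sgraph) : R :=
  let S : set R := null_betas G in xget 0 (S `&` ubound S).

Section SymSpectral.
Import complex.
Local Open Scope complex_scope.
Local Open Scope sesquilinear_scope.
Variables (R : realType) (n : nat) (S : 'M[R]_n).
Hypothesis S_sym : S^T = S.

Lemma sym_spectral : exists d : 'I_n -> R,
  char_poly S = \prod_i ('X - (d i)%:P) /\
  forall v : 'rV[R]_n, exists q : 'I_n -> R,
    [/\ forall i, 0 <= q i, (v *m v^T) 0 0 = \sum_i q i
      & (v *m S *m v^T) 0 0 = \sum_i d i * q i].
Proof.
pose rc := [the {rmorphism R -> R[i]} of real_complex R].
pose A : 'M[R[i]]_n := map_mx rc S.
have realrc (x : R) : rc x \is Num.real.
  by apply/CrealP; apply: conjc_real.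
have Asym : A \is hermsymmx.
  apply: realsym_hermsym.
    apply/is_hermitianmxP; rewrite expr0 scale1r map_mx_id// /A map_trmx.
    by rewrite S_sym.
  by apply/mxOverP => i j; rewrite mxE.
have /hermitian_spectral_diag_real/mxOverP spR := Asym.
have /hermitian_normalmx/orthomx_spectralP := Asym.
set P := spectralmx A; set sp := spectral_diag A => Aeq.
have PU : P \is unitarymx by apply: spectral_unitarymx.
have Pu : P \in unitmx by apply: spectral_unit.
pose d i := complex.Re (sp 0 i).
have dE i : rc (d i) = sp 0 i.
  by apply: RRe_real; apply: spR.
exists d; split.
  apply: (map_inj_poly (@complexI R)); first by [].
  rewrite (map_char_poly rc) -/A rmorph_prod /=.
  have -> : char_poly A = char_poly (diag_mx sp).
    rewrite Aeq /char_poly.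
    have -> : char_poly_mx (invmx P *m diag_mx sp *m P) =
        map_mx polyC (invmx P) *m char_poly_mx (diag_mx sp) *m map_mx polyC P.
      rewrite /char_poly_mx mulmxBr mulmxBl -!map_mxM; congr (_ - _).
      by rewrite scalar_mxC -mulmxA -map_mxM mulVmx// map_mx1 mulmx1.
    rewrite !det_mulmx mulrC mulrA -det_mulmx -map_mxM mulmxV//.
    by rewrite map_mx1 det1 mul1r.
  rewrite char_poly_trig ?diag_mx_is_trig//; apply: eq_bigr => i _.
  by rewrite !mxE eqxx mulr1n rmorphB /= map_polyX map_polyC /= -dE.
move=> v.
pose V : 'rV[R[i]]_n := map_mx rc v.
pose w := V *m P^t*.
have PP : P^t* *m P = 1%:M by apply: mulmx1C; apply/unitarymxP.
have wE : w^t* = P *m V^T.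
  rewrite /w trmx_mul map_mxM trmxCK; congr (_ *m _).
  by apply/matrixP => a b; rewrite !mxE; apply: conjc_real.
pose q i := complex.Re (w 0 i * (w 0 i)^*).
have qE i : rc (q i) = w 0 i * (w 0 i)^*.
  by apply: RRe_real; rewrite ger0_real// mul_conjC_ge0.
exists q; split.
- by move=> i; rewrite -lecR -[(q i)%:C]/(rc (q i)) qE mul_conjC_ge0.
- apply: (@complexI R); rewrite -[LHS]/(rc _) -[RHS]/(rc _) rmorph_sum /=.
  transitivity ((w *m w^t*) 0 0).
    rewrite wE /w mulmxA -(mulmxA V) PP mulmx1 /V map_trmx -map_mxM.
    by rewrite [RHS]mxE.
  by rewrite mxE; apply: eq_bigr => i _; rewrite -[RHS]/(rc _) qE !mxE.
- apply: (@complexI R); rewrite -[LHS]/(rc _) -[RHS]/(rc _) rmorph_sum /=.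
  transitivity ((w *m diag_mx sp *m w^t*) 0 0).
    have -> : w *m diag_mx sp *m w^t* = V *m A *m V^T.
      by rewrite wE /w Aeq invmx_unitary// !mulmxA.
    by rewrite /V /A map_trmx -!map_mxM [RHS]mxE.
  rewrite mxE; apply: eq_bigr => i _.
  rewrite -[RHS]/(rc _) rmorphM /= -[(d i)%:C]/(rc (d i)).
  rewrite -[(q i)%:C]/(rc (q i)) qE dE mul_mx_diag !mxE.
  by rewrite mulrAC mulrC.
Qed.
End SymSpectral.

Lemma perm_eigenvalues (R : realType) (n : nat) (S : 'M[R]_n) (s : seq R) :
  char_poly S = \prod_(x <- s) ('X - x%:P) -> perm_eq (eigenvalues S) s.
Proof.
move=> pE; rewrite /eigenvalues perm_sort; apply/allP => y _ /=; apply/eqP.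
have p0 : char_poly S != 0 by rewrite monic_neq0// char_poly_monic.
have <- : mup y (char_poly S) = count_mem y s by rewrite pE mu_prod_XsubC.
rewrite count_flatten -map_comp sumnE big_map.
have [yr|yr] := boolP (y \in rootsR (char_poly S)).
  rewrite (bigD1_seq y)//=; last exact: uniq_roots.
  rewrite count_nseq /= eqxx mul1n big1 ?addn0// => x xy.
  by rewrite count_nseq /= (negbTE xy) mul0n.
rewrite big_seq big1 => [|x xr]; last first.
  rewrite /= count_nseq /=; case: eqP => // xy.
  by rewrite -xy xr in yr.
rewrite mupNroot//; apply: contra yr => yr.
by rewrite -(roots_on_rootsR p0) inE /=.
Qed.

Lemma eigenvalues_sorted (R : realType) (n : nat) (S : 'M[R]_n) :
  sorted >=%R (eigenvalues S).
Proof. by apply: sort_sorted => x y; apply: le_total. Qed.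

Lemma char_poly_eigenvalues (R : realType) (n : nat) (S : 'M[R]_n) :
  S^T = S -> char_poly S = \prod_(x <- eigenvalues S) ('X - x%:P).
Proof.
move=> /sym_spectral[d [pE _]].
have pE' : char_poly S = \prod_(x <- map d (enum 'I_n)) ('X - x%:P).
  by rewrite big_map big_enum.
by rewrite (perm_big _ (perm_eigenvalues pE')).
Qed.

Lemma size_eigenvalues (R : realType) (n : nat) (S : 'M[R]_n) :
  S^T = S -> size (eigenvalues S) = n.
Proof.
move=> /char_poly_eigenvalues pE; apply: succn_inj.
by rewrite -(size_prod_XsubC (eigenvalues S) id) -pE size_char_poly.
Qed.

Section LeastEigenvalue.
Variables (R : realType) (n : nat) (S : 'M[R]_n).
Hypotheses (S_sym : S^T = S) (n_gt0 : (0 < n)%N).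

Lemma lambda_last_root : root (char_poly S) (lambda S n).
Proof.
rewrite char_poly_eigenvalues// root_prod_XsubC /lambda mem_nth//.
by rewrite size_eigenvalues// ltn_predL.
Qed.

Lemma lambda_last_min x : root (char_poly S) x -> lambda S n <= x.
Proof.
rewrite char_poly_eigenvalues// root_prod_XsubC => xs.
rewrite -(nth_index 0 xs) /lambda.
have ge_trans : transitive (>=%R : rel R) by move=> a b c /= ? /le_trans; apply.
have ge_refl : reflexive (>=%R : rel R) by move=> a /=.
apply: (sorted_leq_nth ge_trans ge_refl 0 (eigenvalues_sorted S)).
- by rewrite inE index_mem.
- by rewrite inE size_eigenvalues// ltn_predL.
- by rewrite -ltnS prednK// -[X in (_ < X)%N](size_eigenvalues S_sym) index_mem.
Qed.

Lemma rayleigh_lambda_last (v : 'rV[R]_n) :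
  lambda S n * (v *m v^T) 0 0 <= (v *m S *m v^T) 0 0.
Proof.
have [d [pE /(_ v)[q [q0 -> ->]]]] := sym_spectral S_sym.
rewrite mulr_sumr; apply: ler_sum => i _; apply: ler_wpM2r => //.
apply: lambda_last_min; rewrite pE rootE horner_prod.
by rewrite (bigD1 i)//= !hornerE subrr mul0r.
Qed.

Lemma lambda_last_eigenvector : exists2 v : 'rV[R]_n,
  (v *m v^T) 0 0 = 1 & (v *m S *m v^T) 0 0 = lambda S n.
Proof.
have := lambda_last_root; rewrite -eigenvalue_root_char.
case/eigenvalueP => v vS v0.
pose c := (v *m v^T) 0 0.
have cE : c = \sum_i v 0 i ^+ 2.
  by rewrite /c mxE; apply: eq_bigr => i _; rewrite mxE expr2.
have c0 : 0 < c.
  rewrite lt_neqAle cE sumr_ge0 ?andbT => [|i _]; last exact: sqr_ge0.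
  apply: contra v0 => /eqP/esym/eqP; rewrite psumr_eq0 => [/allP v2|i _]; last exact: sqr_ge0.
  apply/eqP/rowP => i; rewrite mxE; apply/eqP; rewrite -sqrf_eq0.
  by apply: v2; rewrite mem_index_enum.
have cs : (Num.sqrt c)^-1 * (Num.sqrt c)^-1 * c = 1.
  by rewrite -invfM -expr2 sqr_sqrtr ?ltW// mulVf// gt_eqF.
exists ((Num.sqrt c)^-1 *: v).
  by rewrite linearZ /= -scalemxAl -scalemxAr scalerA mxE -/c.
rewrite linearZ /= -!scalemxAl -scalemxAr vS -scalemxAl !scalerA mxE -/c.
rewrite -[RHS]mul1r -cs; ring.
Qed.

End LeastEigenvalue.

Lemma max_zero (R : realType) (f : R -> R) (S : set R) :
    S = [set b | 0 < b < 1 /\ f b = 0] ->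
  continuous f -> 0 <= f 2^-1 -> f 1 < 0 -> exists b, (S `&` ubound S) b.
Proof.
move=> -> f_cont fh f1; have half_01 : (2^-1 : R) <= 1 by lra.
pose Z : set R := `[2^-1, 1] `&` f @^-1` [set 0].
have Z0 : Z !=set0.
  have fv : Num.min (f 2^-1) (f 1) <= 0 <= Num.max (f 2^-1) (f 1).
    by rewrite ge_min (ltW f1) orbT le_max fh.
  by have [c c01 fc] := IVT half_01 (continuous_subspaceT f_cont) fv; exists c.
have Zc : compact Z.
  apply: compact_closedI; first exact: segment_compact.
  apply: closed_comp => [x _|]; first exact: f_cont.
  exact: closed_eq.
have [|c /set_mem[c01 fc] cmax] := @compact_EVT_max R R id Z Z0 Zc.
  by apply: continuous_subspaceT => x; exact: cvg_id.
move: c01; rewrite /= in_itv /= => /andP[c_ge c_le].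
exists c; split.
  split => //; rewrite (lt_le_trans _ c_ge) ?invr_gt0//= lt_neqAle c_le andbT.
  by apply/eqP => c1; move: f1; rewrite -c1 fc ltxx.
move=> b [/andP[b0 b1] fb].
have [bh|bh] := leP b 2^-1; first exact: le_trans bh c_ge.
by apply: cmax; apply/mem_set; split => //=; rewrite in_itv /= (ltW bh) (ltW b1).
Qed.

Section BetaO.
Variables (R : realType) (G : sgraph).
Let n := #|G|.
Let B (b : R) := Bmx G b.
Let f (b : R) := lambda (B b) n.

Lemma Bmx_sym b : (B b)^T = B b.
Proof.
have Asym : (adjmx R G)^T = adjmx R G.
  by apply/matrixP => i j; rewrite !mxE adj_sym.
rewrite /B /Bmx /laplacian linearD !linearZ /= linearB /= Asym.
by rewrite /degmx tr_diag_mx.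
Qed.

(* Slope of the affine map B. *)
Let M : 'M[R]_n := adjmx R G - laplacian R G.

Lemma BmxD a b : B b = B a + (b - a) *: M.
Proof.
rewrite /B /Bmx /M; apply/matrixP => i j; rewrite !mxE.
by ring.
Qed.

Lemma M_sym : M^T = M.
Proof.
have -> : M = B 1 - B 0 by rewrite (BmxD 0 1) addrAC subrr add0r subr0 scale1r.
by rewrite linearB /= !Bmx_sym.
Qed.

Hypothesis G_edge : has_edge G.

Lemma has_edge_gt0 : (0 < n)%N.
Proof. by case: G_edge => x _; apply/card_gt0P; exists x. Qed.
Let n_gt0 := has_edge_gt0.

Lemma lambda_Bmx_lip : exists K, forall a b, `|f a - f b| <= K * `|a - b|.
Proof.
pose K := Num.max (- lambda M n) (- lambda (- M) n).
have NM_sym : (- M)^T = - M by rewrite linearN /= M_sym.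
have low a b : f a - f b <= K * `|a - b|.
  have [v v1 vB] := lambda_last_eigenvector (Bmx_sym b) n_gt0.
  have := rayleigh_lambda_last (Bmx_sym a) n_gt0 v.
  have -> : (v *m B a *m v^T) 0 0 =
      (v *m B b *m v^T) 0 0 + (a - b) * (v *m M *m v^T) 0 0.
    rewrite (BmxD b a); move: (B b) M => X Y.
    by rewrite mulmxDr mulmxDl -scalemxAr -scalemxAl mxE [X in _ + X]mxE.
  rewrite v1 mulr1 vB -/(f a) -/(f b) -lerBlDl => /le_trans; apply.
  have hM := rayleigh_lambda_last M_sym n_gt0 v.
  have hN := rayleigh_lambda_last NM_sym n_gt0 v.
  rewrite v1 mulr1 in hM; rewrite v1 mulr1 mulmxN mulNmx [leRHS]mxE in hN.
  have K1 : - lambda M n <= K by rewrite le_max lexx.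
  have K2 : - lambda (- M) n <= K by rewrite le_max lexx orbT.
  have hK : `|(v *m M *m v^T) 0 0| <= K.
    by rewrite ler_norml lerNl (le_trans _ K1) ?lerN2// (le_trans _ K2)// lerNr.
  by rewrite (le_trans (ler_norm _))// normrM mulrC ler_wpM2r.
exists K => a b; rewrite ler_norml low andbT.
by rewrite lerNl opprB distrC low.
Qed.

Lemma lambda_Bmx_continuous : continuous f.
Proof.
have [K fK] := lambda_Bmx_lip.
move=> x; apply/cvgrPdist_lt => e e0.
pose K' := Num.max K 1.
have K'0 : 0 < K' by rewrite lt_max ltr01 orbT.
near=> y.
apply: le_lt_trans (fK _ _) _.
apply: (@le_lt_trans _ _ (K' * `|x - y|)).
  by apply: ler_wpM2r => //; rewrite le_max lexx.
rewrite mulrC -ltr_pdivlMr//; near: y.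
by apply: cvgr_dist_lt => //; rewrite divr_gt0.
Unshelve. all: by end_near. Qed.

Lemma lambda_Bmx_half : 0 <= f 2^-1.
Proof.
have [v _] := lambda_last_eigenvector (Bmx_sym 2^-1) n_gt0.
rewrite -/(f _) => <-.
have -> : B 2^-1 = 2^-1 *: degmx R G.
  rewrite /B /Bmx /laplacian scalerBr.
  have -> : 1 - 2^-1 = 2^-1 :> R by field.
  by rewrite addrC subrK.
rewrite -scalemxAr -scalemxAl mxE mulr_ge0 ?invr_ge0//.
rewrite mxE sumr_ge0// => i _; rewrite mul_mx_diag !mxE mulrAC -expr2.
by rewrite mulr_ge0 ?sqr_ge0.
Qed.

Lemma lambda_Bmx_one : f 1 < 0.
Proof.
have [x [y xy]] := G_edge.
have xNy : x != y by apply: contraTneq xy => ->; rewrite adj_irr.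
pose v : 'rV[R]_n := delta_mx 0 (enum_rank x) - delta_mx 0 (enum_rank y).
have := rayleigh_lambda_last (Bmx_sym 1) n_gt0 v.
rewrite -/(f 1).
have rxy : (enum_rank x == enum_rank y) = false.
  by apply/negbTE; rewrite (inj_eq enum_rank_inj).
have vN (N : 'M[R]_n) : (v *m N *m v^T) 0 0 =
    N (enum_rank x) (enum_rank x) - N (enum_rank x) (enum_rank y)
    - N (enum_rank y) (enum_rank x) + N (enum_rank y) (enum_rank y).
  rewrite /v linearB /= !trmx_delta mulmxBr !mulmxBl -!rowE -!colE !mxE.
  by ring.
have := vN 1%:M; rewrite mulmx1 => ->.
rewrite vN /B /Bmx subrr scale0r scale1r addr0 !mxE !enum_rankK !adj_irr.
rewrite (adj_sym y x) xy !eqxx rxy eq_sym rxy /= => h; lra.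
Qed.

Lemma beta_oP : let S : set R := null_betas G in
  S (beta_o R G) /\ ubound S (beta_o R G).
Proof.
move=> S; suff /xgetPex : exists b, (S `&` ubound S) b by apply.
exact: max_zero erefl lambda_Bmx_continuous lambda_Bmx_half lambda_Bmx_one.
Qed.

End BetaO.

(* Main.v *)
Require Import Defs.
From mathcomp Require Import all_boot all_order all_algebra.
From mathcomp Require Import ring.
From mathcomp Require Import all_classical all_reals all_analysis.

(** Fix a proper colouring with k colours and let B be a positive semidefinite
    matrix all of whose nonzero off-diagonal entries join vertices of different
    colours. The all-ones vector is the sum of the k indicator vectors u_c of
    the colour classes, so convexity of the quadratic form of B gives

      (sum of the entries of B) = q(u_1 + ... + u_k)
                               <= k (q(u_1) + ... + q(u_k)) = k tr B,

    the last equality because B is diagonal inside each class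
    ([psd_sum_le_trace]).

    The matrix B_beta is of this kind when its least eigenvalue is nonnegative.
    If a is the sum of the degrees, its trace is (1 - beta) a, and the sum of
    its entries is beta a since the rows of the Laplacian sum to zero. As a > 0,
    beta <= k (1 - beta) for every such beta, in particular for beta_o. *)

Import Order.TTheory GRing.Theory Num.Theory.
Local Open Scope ring_scope.

Lemma quadratic_formE (R : comPzRingType) (n : nat) (S : 'M[R]_n)
    (v : 'rV[R]_n) :
  (v *m S *m v^T) 0 0 = \sum_i \sum_j S i j * (v 0 i * v 0 j).
Proof.
rewrite mxE exchange_big /=; apply: eq_bigr => j _.
rewrite !mxE mulr_suml; apply: eq_bigr => i _; ring.
Qed.

(** The weight of an entry S i j, with i in class a and j in class b, in the sum
    of the quadratic forms of S at all differences of indicator vectors of the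
    k classes. *)
Lemma sum_indicator_differences (R : comPzRingType) (k : nat) (a b : 'I_k) :
  \sum_(c < k) \sum_(d < k)
     ((a == c)%:R - (a == d)%:R) * ((b == c)%:R - (b == d)%:R)
  = 2 * (k%:R * (a == b)%:R - 1) :> R.
Proof.
have one (x : 'I_k) : \sum_(c < k) (x == c)%:R = 1 :> R.
  rewrite (bigD1 x)//= eqxx big1 ?addr0// => c.
  by rewrite eq_sym => /negbTE->.
have both : \sum_(c < k) (a == c)%:R * (b == c)%:R = (a == b)%:R :> R.
  rewrite (bigD1 a)//= eqxx mul1r big1 ?addr0 1?eq_sym// => c.
  by rewrite eq_sym => /negbTE->; rewrite mul0r.
transitivity (\sum_(c < k) (k%:R * ((a == c)%:R * (b == c)%:R)
    - (a == c)%:R - (b == c)%:R + (a == b)%:R) : R).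
  apply: eq_bigr => c _.
  transitivity (\sum_(d < k) ((a == c)%:R * (b == c)%:R
      - (a == c)%:R * (b == d)%:R - (b == c)%:R * (a == d)%:R
      + (a == d)%:R * (b == d)%:R) : R).
    by apply: eq_bigr => d _; ring.
  rewrite big_split !sumrB /= both -!mulr_sumr !one !mulr1.
  by rewrite sumr_const card_ord -[_ *+ k]mulr_natl; ring.
rewrite big_split !sumrB /= -mulr_sumr both !one sumr_const card_ord.
by rewrite -[_ *+ k]mulr_natl; ring.
Qed.

(** Convexity of the quadratic form q of S, in the form
    sum_(c, d) q(u_c - u_d) = 2 k sum_c q(u_c) - 2 q(sum_c u_c)
    for the indicator vectors u_c of the classes of f. Since S is diagonal inside
    each class, q(u_c) is the sum of the diagonal entries over the class. *)
Lemma psd_sum_le_trace (R : numDomainType) (n k : nat) (S : 'M[R]_n)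
    (f : 'I_n -> 'I_k) :
  (forall v : 'rV[R]_n, 0 <= (v *m S *m v^T) 0 0) ->
  (forall i j, i != j -> f i = f j -> S i j = 0) ->
  \sum_i \sum_j S i j <= k%:R * \tr S.
Proof.
move=> S_psd S_class.
pose v c d : 'rV[R]_n := \row_i ((f i == c)%:R - (f i == d)%:R).
have : 0 <= \sum_(c < k) \sum_(d < k) (v c d *m S *m (v c d)^T) 0 0.
  by apply: sumr_ge0 => c _; apply: sumr_ge0 => d _; apply: S_psd.
suff -> : \sum_(c < k) \sum_(d < k) (v c d *m S *m (v c d)^T) 0 0 =
    2 * (k%:R * \tr S - \sum_i \sum_j S i j).
  by rewrite pmulr_rge0// subr_ge0.
transitivity (\sum_i \sum_j S i j * (\sum_(c < k) \sum_(d < k)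
    ((f i == c)%:R - (f i == d)%:R) * ((f j == c)%:R - (f j == d)%:R))).
  under eq_bigr => c _ do under eq_bigr => d _ do rewrite quadratic_formE.
  under eq_bigr => c _ do rewrite exchange_big /=.
  rewrite exchange_big; apply: eq_bigr => i _ /=.
  under eq_bigr => c _ do rewrite exchange_big /=.
  rewrite exchange_big; apply: eq_bigr => j _ /=.
  rewrite mulr_sumr; apply: eq_bigr => c _; rewrite mulr_sumr.
  by apply: eq_bigr => d _; rewrite !mxE.
rewrite /mxtrace mulr_sumr -sumrB mulr_sumr; apply: eq_bigr => i _.
(* Off the diagonal, S i j vanishes or i and j lie in different classes, and
   then the weight is -2. *)
rewrite (bigD1 i)//= [X in _ - X](bigD1 i)//= sum_indicator_differences eqxx.
rewrite mulr1 [X in _ + X](_ : _ = - 2 * \sum_(j | j != i) S i j); first ring.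
rewrite mulr_sumr; apply: eq_bigr => j ji; rewrite sum_indicator_differences.
case: eqP => [/S_class ->|_]; [by rewrite mul0r mulr0|by rewrite eq_sym|].
by rewrite mulr0; ring.
Qed.

Section BetaMatrix.
Variables (R : realType) (G : sgraph).

Definition degree_sum : nat := \sum_(i < #|G|) degree (enum_val i).

Lemma degree_sum_gt0 : has_edge G -> (0 < degree_sum)%N.
Proof.
move=> [x [y xy]]; rewrite /degree_sum (bigD1 (enum_rank x))//= enum_rankK.
by rewrite addn_gt0; apply/orP; left; apply/card_gt0P; exists y.
Qed.

Lemma sum_adjmx_row i : \sum_j adjmx R G i j = (degree (enum_val i))%:R.
Proof.
under eq_bigr => j _ do rewrite mxE.
rewrite -(big_enum_val (fun y : G => (adj (enum_val i) y)%:R)) /=.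
by rewrite /degree -natr_sum -sum1_card [in RHS]big_mkcond.
Qed.

Lemma trace_Bmx (b : R) : \tr (Bmx G b) = (1 - b) * degree_sum%:R.
Proof.
rewrite natr_sum mulr_sumr; apply: eq_bigr => i _.
by rewrite !mxE eqxx adj_irr /=; ring.
Qed.

Lemma sum_Bmx (b : R) : \sum_i \sum_j Bmx G b i j = b * degree_sum%:R.
Proof.
rewrite natr_sum mulr_sumr; apply: eq_bigr => i _.
transitivity (\sum_j (b * adjmx R G i j
    + (1 - b) * (degmx R G i j - adjmx R G i j))).
  by apply: eq_bigr => j _; rewrite !mxE.
have deg_row : \sum_j degmx R G i j = (degree (enum_val i))%:R.
  rewrite (bigD1 i)//= !mxE eqxx mulr1n big1 ?addr0// => j.
  by rewrite !mxE eq_sym => /negbTE->.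
rewrite big_split /= -!mulr_sumr sumrB deg_row sum_adjmx_row; ring.
Qed.

Lemma colorable_beta_le k (b : R) : colorable G k -> has_edge G ->
  0 <= lambda (Bmx G b) #|G| -> b <= k%:R * (1 - b).
Proof.
move=> /existsP[f /forallP f_proper] G_edge lambda_ge0.
rewrite -(ler_pM2r (x := degree_sum%:R)) ?ltr0n ?degree_sum_gt0//.
rewrite -mulrA -trace_Bmx -sum_Bmx.
apply: (psd_sum_le_trace _ _ _ _ (fun i => f (enum_val i))) => [v|i j ij fij].
  have := rayleigh_lambda_last (Bmx_sym G b) (has_edge_gt0 G_edge) v.
  apply: le_trans; apply: mulr_ge0 => //.
  by rewrite mxE sumr_ge0// => i _; rewrite mxE -expr2 sqr_ge0.
have /forallP/(_ (enum_val j)) := f_proper (enum_val i).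
by rewrite fij eqxx implybF !mxE (negbTE ij) => /negbTE-> /=; ring.
Qed.

End BetaMatrix.

Theorem corollary4p6 (R : realType) (G : sgraph) (hG : has_edge G) :
  beta_o R G / (1 - beta_o R G) <= (chromatic_number G)%:R.
Proof.
have [[/andP[_ b_lt1] lambda0] _] := beta_oP R hG.
rewrite ler_pdivrMr ?subr_gt0//; apply: (colorable_beta_le _ G) => //.
  by rewrite /chromatic_number; case: ex_minnP.
by rewrite lambda0.
Qed.
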